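(* Let $(X,\mathcal{E})$ be a coarse space. The following are equivalent: (1) there is a sequence $(n_i)_{i\ge 1}$ of positive integers such that for every sequence $K_1,K_2,\ldots$ of entourages there is a finite sequence $\mathcal{V}_1,\ldots,\mathcal{V}_r$ of families of subsets of $X$ such that $\mathcal{V}_1=\{X\}$, every $V\in\mathcal{V}_i$ admits a $(K_i,n_i)$-decomposition over $\mathcal{V}_{i+1}$ (for each $1\le i<r$), and $\mathcal{V}_r$ is uniformly bounded; (2) for every sequence $L_1,L_2,\ldots$ of entourages there is a finite sequence $\mathcal{U}_1,\ldots,\mathcal{U}_s$ of families of subsets of $X$ such that $\mathcal{U}_1=\{X\}$, every $U\in\mathcal{U}_i$ admits an $(L_i,2)$-decomposition over $\mathcal{U}_{i+1}$ (for each $1\le i<s$), and $\mathcal{U}_s$ is uniformly bounded.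
   Context: Coarse spaces. For a set $X$ and $E,F\subseteq X\times X$, the inverse is $E^{-1}=\{(y,x): (x,y)\in E\}$ and the composition is $E\circ F=\{(x,z): \exists y\in X,\ (x,y)\in E \text{ and } (y,z)\in F\}$. A coarse structure on $X$ is a collection $\mathcal{E}$ of subsets of $X\times X$ that contains the diagonal $\{(x,x):x\in X\}$ and is closed under taking subsets, finite unions, inverses, and compositions. Elements of $\mathcal{E}$ are called entourages, and $(X,\mathcal{E})$ is called a coarse space. A family $\mathcal{U}$ of subsets of $X$ is uniformly bounded if $\bigcup_{U\in\mathcal{U}}U\times U\in\mathcal{E}$. Decompositions. Let $Y\subseteq X$, let $\mathcal{U}$ be a family of subsets of $X$, let $n$ be a positive integer and let $E\in\mathcal{E}$. One says that $Y$ admits an $(E,n)$-decomposition over $\mathcal{U}$ if $Y$ can be expressed as a union of $n$ sets $Y^1,\ldots,Y^n$ such that each $Y^i$ is an $E$-disjoint union of sets from $\mathcal{U}$, meaning that $Y^i=\bigsqcup_j Y^i_j$ (disjoint union), where $Y^i_j\in\mathcal{U}$ for all $j$ and $(Y^i_j\times Y^i_{j'})\cap E=\emptyset$ whenever $j\ne j'$. (Terminology: condition (1) is the coarse version of Dydak's countable asymptotic dimension; condition (2) is straight finite coarse decomposition complexity, sFCDC.) *)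

(* Defs.v *)
From mathcomp Require Import all_boot.
From mathcomp Require Import boolp classical_sets.

Set Implicit Arguments.
Unset Strict Implicit.
Unset Printing Implicit Defensive.

Local Open Scope classical_set_scope.
Local Open Scope relation_scope.

(* The usual relational composite E o F = {(x, z) | exists y, (x, y) \in E and
   (y, z) \in F} is [F \; E] here. *)
Record coarse_structure (X : Type) := CoarseStructure {
  is_entourage : set (set (X * X));
  entourage_diagonal : is_entourage diagonal;
  entourage_subset : forall E F : set (X * X),
    is_entourage E -> F `<=` E -> is_entourage F;
  entourage_setU : forall E F : set (X * X),
    is_entourage E -> is_entourage F -> is_entourage (E `|` F);
  entourage_inverse : forall E : set (X * X),
    is_entourage E -> is_entourage E^-1;
  entourage_compose : forall E F : set (X * X),
    is_entourage E -> is_entourage F -> is_entourage (F \; E)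
}.

Definition uniformly_bounded (X : Type) (C : coarse_structure X)
    (U : set (set X)) : Prop :=
  is_entourage C (\bigcup_(A in U) (A `*` A)).

(* As [trivIset] compares indices, repeated pieces must be empty. *)
Definition disjoint_union_over (X : Type) (E : set (X * X))
    (U : set (set X)) (Y : set X) : Prop :=
  exists (J : Type) (P : J -> set X),
    [/\ forall j, U (P j),
        Y = \bigcup_j P j,
        trivIset setT P &
        forall j j', j <> j' -> (P j `*` P j') `&` E = set0].

Definition admits_decomposition (X : Type) (E : set (X * X)) (n : nat)
    (U : set (set X)) (Y : set X) : Prop :=
  exists Z : 'I_n -> set X,
    Y = \bigcup_i Z i /\ forall i, disjoint_union_over E U (Z i).

(* The sequences [K], [n] and the families [V 1], ..., [V r] are indexed from
   1; their values at other indices are irrelevant. *)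
Definition has_finite_decomposition (X : Type) (C : coarse_structure X)
    (n : nat -> nat) (K : nat -> set (X * X)) : Prop :=
  exists (r : nat) (V : nat -> set (set X)),
    [/\ 1 <= r,
        V 1 = [set setT],
        forall i, 1 <= i < r ->
          forall A, V i A -> admits_decomposition (K i) (n i) (V i.+1) A &
        uniformly_bounded C (V r)].

Definition countable_asdim (X : Type) (C : coarse_structure X) : Prop :=
  exists n : nat -> nat,
    (forall i, 1 <= i -> 0 < n i) /\
    forall K : nat -> set (X * X),
      (forall i, 1 <= i -> is_entourage C (K i)) ->
      has_finite_decomposition C n K.

Definition straight_FCDC (X : Type) (C : coarse_structure X) : Prop :=
  forall L : nat -> set (X * X),
    (forall i, 1 <= i -> is_entourage C (L i)) ->
    has_finite_decomposition C (fun=> 2) L.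

(* Main.v *)
Require Import Defs.
From mathcomp Require Import all_boot.
From mathcomp Require Import boolp classical_sets.

(** Condition (2) is the instance [n = 2] of condition (1). Conversely, a
    decomposition of [A] into [m] parts, each an [E]-disjoint union of sets of
    a family [V], can be carried out by [m] successive binary decompositions:
    peel off one part at a time, so that each step leaves sets of [V] together
    with a single set that has one part fewer ([binary_reduction_block]).
    Each of the [m] steps uses its own entourage [L j], and it suffices that
    all of them are contained in [E].

    Since the numbers [n i] do not depend on the entourages, the indices
    [1, 2, ...] can be cut beforehand into consecutive blocks of lengths
    [n 1, n 2, ...]. Given [L], condition (1) is applied to the sequence whose
    [i]-th term is the union of the [L j] over the [i]-th block, an entourage
    because the block is finite, and the [i]-th step of the chain obtained is
    then replaced by the binary steps of the [i]-th block. *)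

Set Implicit Arguments.
Unset Strict Implicit.
Unset Printing Implicit Defensive.

Local Open Scope classical_set_scope.

Section Decompositions.
Variable X : Type.
Implicit Types (E : set (X * X)) (U : set (set X)) (A B D : set X).

Lemma disjoint_union_over_mono E E' U U' A :
  E' `<=` E -> U `<=` U' ->
  disjoint_union_over E U A -> disjoint_union_over E' U' A.
Proof.
move=> E'E UU' [J [P [PU AP trivP disjP]]].
exists J, P; split=> // [j|j j' /disjP EP]; first exact: UU'.
by rewrite -subset0 -EP; apply: setIS.
Qed.

Lemma disjoint_union_over_single E U A : U A -> disjoint_union_over E U A.
Proof.
move=> UA; exists unit, (fun=> A); split=> //.
- by apply/seteqP; split=> [x Ax|x [_ _ //]]; exists tt.
- by move=> [] [].
- by move=> [] [].
Qed.

Lemma admits_decomposition2 E U B D :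
  disjoint_union_over E U B -> disjoint_union_over E U D ->
  admits_decomposition E 2 U (B `|` D).
Proof.
move=> UB UD; exists (fun i : 'I_2 => if i == ord0 then B else D); split.
  apply/seteqP; split=> [x [Bx|Dx]|x [i _]].
  - by exists ord0.
  - by exists ord_max.
  - by case: ifP => _; [left|right].
by move=> i; case: ifP.
Qed.

Lemma admits_decomposition2_mem E U A :
  U A -> admits_decomposition E 2 U A.
Proof.
move=> UA; rewrite -(setUid A).
by apply: admits_decomposition2; apply: disjoint_union_over_single.
Qed.

Lemma admits_decompositionS E m U A :
  admits_decomposition E m.+1 U A ->
  exists B D, [/\ A = B `|` D, disjoint_union_over E U B &
                  admits_decomposition E m U D].
Proof.
move=> [Z [-> UZ]]; exists (Z ord0), (\bigcup_i Z (lift ord0 i)); split=> //.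
  apply/seteqP; split=> [x [i _]|x [Zx|[i _ Zx]]].
  - by case: (unliftP ord0 i) => [j|] -> Zx; [right; exists j|left].
  - by exists ord0.
  - by exists (lift ord0 i).
by exists (fun i => Z (lift ord0 i)); split=> // i.
Qed.

Lemma admits_decomposition1 E U A :
  admits_decomposition E 1 U A -> disjoint_union_over E U A.
Proof.
move=> [Z [-> UZ]]; suff -> : \bigcup_i Z i = Z ord0 by [].
by apply/seteqP; split=> [x [i _]|x Zx]; [rewrite (ord1 i)|exists ord0].
Qed.

End Decompositions.

Section Reductions.
Variables (X : Type) (C : coarse_structure X).
Implicit Types (E : set (X * X)) (K L : nat -> set (X * X)).
Implicit Types (n : nat -> nat) (U V : set (set X)).

(** A chain of [r] decompositions that starts at an arbitrary family [U] and
    uses the entourages of index [a, a + 1, ...]. With both the start and the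
    initial family free, a block of steps can be prepended to a chain, which
    [has_finite_decomposition] does not allow. *)
Fixpoint reducible n K r a U : Prop :=
  if r is r'.+1 then
    exists V, (forall A, U A -> admits_decomposition (K a) (n a) V A) /\
      reducible n K r' a.+1 V
  else uniformly_bounded C U.

Lemma reducible_chain n K r a U : reducible n K r a U <->
  exists V : nat -> set (set X),
    [/\ V a = U,
        forall i, a <= i < a + r ->
          forall A, V i A -> admits_decomposition (K i) (n i) (V i.+1) A &
        uniformly_bounded C (V (a + r))].
Proof.
elim: r a U => [|r IHr] a U /=.
  rewrite addn0; split=> [UC|[V [<-]]//]; exists (fun=> U); split=> // i.
  by case: ltngtP.
split=> [[V [UV /IHr[W [Wa WK WC]]]]|[V [<- VK VC]]]; last first.
  exists (V a.+1); split; first by apply: VK; rewrite leqnn addnS ltnS leq_addr.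
  apply/IHr; exists V; split=> //; last by rewrite addSnnS.
  by move=> i /andP[ai ir]; apply: VK; rewrite (ltnW ai) -addSnnS.
exists (fun i => if i == a then U else W i); split; rewrite ?eqxx //.
  move=> i /andP[ai ir]; have -> : (i.+1 == a) = false.
    by apply/negbTE; rewrite gtn_eqF // ltnS.
  case: eqVneq => [->|ia A]; first by rewrite Wa.
  by apply: WK; rewrite ltn_neqAle eq_sym ia ai addSnnS.
by rewrite gtn_eqF -?addSnnS // addSn ltnS leq_addr.
Qed.

Lemma has_finite_decompositionP n K : has_finite_decomposition C n K <->
  exists r, reducible n K r 1 [set setT].
Proof.
split=> [[[|r] [V [// _ V1 VK VC]]]|[r /reducible_chain[V [V1 VK VC]]]].
  by exists r; apply/reducible_chain; exists V.
by exists r.+1, V.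
Qed.

(** The disjunction in the hypothesis on [U] makes the induction on [m] go
    through: after one part has been peeled off, the family consists of the
    sets already in [V], which are carried along as they are, and of the remainders,
    which still have to be cut into [m - 1] parts. *)
Lemma binary_reduction_block L E V m a s U :
  0 < m -> (forall j, a <= j < a + m -> L j `<=` E) ->
  (forall A, U A -> V A \/ admits_decomposition E m V A) ->
  reducible (fun=> 2) L s (a + m) V ->
  reducible (fun=> 2) L (m + s) a U.
Proof.
case: m => // m _; elim: m a U => [|m IHm] a U LE UV VC.
  have LaE : L a `<=` E by apply: LE; rewrite leqnn addn1 ltnSn.
  exists V; split; last by move: VC; rewrite addn1.
  move=> A /UV[|/admits_decomposition1 VA]; first exact: admits_decomposition2_mem.
  rewrite -(setUid A).
  by apply: admits_decomposition2; apply: disjoint_union_over_mono VA.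
have LaE : L a `<=` E by apply: LE; rewrite leqnn addnS ltnS leq_addr.
exists (V `|` admits_decomposition E m.+1 V); split; last first.
  apply: IHm => //; last by rewrite addSnnS.
  by move=> j /andP[aj jm]; apply: LE; rewrite (ltnW aj) -addSnnS.
move=> A /UV[VA|/admits_decompositionS[B [D [-> VB VD]]]].
  by apply: admits_decomposition2_mem; left.
apply: admits_decomposition2; last by apply: disjoint_union_over_single; right.
by apply: disjoint_union_over_mono VB => // ?; left.
Qed.

Lemma is_entourage_bigsetU L (s : seq nat) :
  (forall j, j \in s -> is_entourage C (L j)) ->
  is_entourage C (\bigcup_(j in [set` s]) L j).
Proof.
move=> LC; rewrite bigcup_seq big_seq.
elim/big_ind: _ => //; last exact: entourage_setU.
by apply: entourage_subset (entourage_diagonal C) _; apply: sub0set.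
Qed.

Lemma has_finite_decomposition2 n L :
  (forall i, 1 <= i -> 0 < n i) ->
  (forall i, 1 <= i -> is_entourage C (L i)) ->
  (forall K, (forall i, 1 <= i -> is_entourage C (K i)) ->
     has_finite_decomposition C n K) ->
  has_finite_decomposition C (fun=> 2) L.
Proof.
move=> n_gt0 LC nC.
(* The first index of the i-th block; the first block starts at 1. *)
pose p i := (\sum_(1 <= l < i) n l).+1.
have pS i : 1 <= i -> p i.+1 = p i + n i by move=> ?; rewrite /p big_nat_recr.
pose K i := \bigcup_(j in [set` iota (p i) (n i)]) L j.
have LK i j : p i <= j < p i + n i -> L j `<=` K i.
  by move=> pj x Lx; exists j; rewrite //= mem_iota.
have /nC/has_finite_decompositionP[r KC] i : 1 <= i -> is_entourage C (K i).
  move=> _; apply: is_entourage_bigsetU => j; rewrite mem_iota => /andP[pj _].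
  by apply: LC; apply: leq_trans pj.
apply/has_finite_decompositionP.
suff blocks i U : 1 <= i -> reducible n K r i U ->
    exists s, reducible (fun=> 2) L s (p i) U.
  by have := blocks 1 _ isT KC; rewrite /p big_geq.
elim: r {KC} i U => [|r IHr] i U i_gt0; first by exists 0.
move=> [V [UV /(IHr _ _ (ltn0Sn i))[s]]]; rewrite pS // => VC.
exists (n i + s); apply: (binary_reduction_block (n_gt0 i i_gt0) (LK i)) VC.
by move=> A /UV; right.
Qed.

End Reductions.

Theorem proposition2p2 (X : Type) (C : coarse_structure X) :
  countable_asdim C <-> straight_FCDC C.
Proof.
split=> [[n [n_gt0 nC]] L LC|C2]; last by exists (fun=> 2).
exact: has_finite_decomposition2 n_gt0 LC nC.
Qed.
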